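(* Suppose $X=(x_1,\dots,x_n)$ is an $n$-frame in $V(\mathbb R)$ with $U:=\mathrm{span}(X)=\mathrm{span}\{u_0,w_1,\dots,w_{n-1}\}$. Then $$\varphi_n(Z(t,b',b''),X)=2^{n/2}\,\tfrac12\det g(X)\;e^{-\pi\,\mathrm{tr}(X,X)_{Z(t,b',0)}}\;t^{-n-1}\,dt\wedge db_1\wedge\dots\wedge db_{n-1},$$ where $g(X)$ is the matrix expressing the basis $X$ for $U$ in terms of the basis $\{u_0,w_1,\dots,w_{n-1}\}$ for $U$, i.e. $(x_1,\dots,x_n)=(u_0,w_1,\dots,w_{n-1})\,g(X)$.
   Context: $V$ is a $\mathbb Q$-vector space of dimension $p+1$ with an orientation and a symmetric bilinear form $(\,,)$ of signature $(p,1)$, and $1\le n\le p$. A Witt basis of $V$ is a positively oriented basis $u_0,w_1,\dots,w_{p-1},u_0'$ with $u_0,u_0'$ isotropic, $(u_0,u_0')=-\frac12$, and $w_1,\dots,w_{p-1}$ a basis of the positive definite space $W=\{u_0,u_0'\}^\perp$. Let $B$ be the component of $\{Z\in V(\mathbb R):(Z,Z)=-1\}$ containing $Z_0=u_0+u_0'$, with $T_Z(B)=Z^\perp$. For $t>0$ and $b\in W(\mathbb R)$ put $Z(t,b)=(t+t^{-1}(b,b))u_0+t^{-1}b+t^{-1}u_0'\in B$. Let $U'=U\cap W=\mathrm{span}\{w_1,\dots,w_{n-1}\}$ and let $U''$ be the orthogonal complement of $U'$ in $W$. Identify $W(\mathbb R)$ with $\mathbb R^{p-1}$, $b=(b_1,\dots,b_{p-1})$,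 compatibly with $W=U'\oplus U''$: $b=(b',b'')$ with $b'=(b_1,\dots,b_{n-1})\in U'$ and $b''=(b_n,\dots,b_{p-1})\in U''$, and $Z(t,b',b'')=Z(t,b)$. The coordinates $b_i$ are those with respect to vectors $e_2,\dots,e_p$ of $W(\mathbb R)$ (that is, $b=\sum_i b_ie_{i+1}$) which together with $e_1=u_0-u_0'$ form an orthonormal basis $e_1,\dots,e_p$ of $Z_0^\perp$. For $Z\in B$, $(\,,)_Z$ is the positive definite form equal to $(\,,)$ on $Z^\perp$ and $-(\,,)$ on $\mathbb RZ$ (with $Z^\perp$ and $\mathbb RZ$ orthogonal), and $(X,X)_Z=((x_i,x_j)_Z)$. $\varphi_n(Z,X)$ is the $n$-form on $B$ with $\varphi_n(Z,X)(\xi_1,\dots,\xi_n)=2^{n/2}\det((x_i,\xi_j))\,e^{-\pi\,\mathrm{tr}(X,X)_Z}$ for $\xi_j\in T_Z(B)$.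
   Formalization: The displayed formula is proved with an extra factor on the right, the determinant of w_1,…,w_{n-1} with respect to the orthonormal e_2,…,e_n; it holds as displayed exactly when this determinant is 1 (e.g. w_i=e_{i+1}), and fails otherwise (e.g. p=n=2, (w_1,w_1)=4). *)

(* Defs.v *)
From HB Require Import structures.
From mathcomp Require Import all_boot all_order all_algebra.
From mathcomp Require Import all_classical all_reals all_analysis.
From mathcomp Require Import ring lra.

Set Implicit Arguments.
Unset Strict Implicit.
Unset Printing Implicit Defensive.

Import Order.TTheory GRing.Theory Num.Theory.
Import numFieldNormedType.Exports.

Local Open Scope classical_set_scope.
Local Open Scope ring_scope.

(* (x_1, ..., x_n) = (e_1, ..., e_n) * coord_mx e x, provided that e is free and
   the x_j lie in its span: the j-th COLUMN holds the coordinates of x_j. *)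
Definition coord_mx (K : fieldType) (E : vectType K) (n : nat)
    (e x : n.-tuple E) : 'M[K]_n :=
  \matrix_(i, j) coord e i (tnth x j).

(* (s_1, ..., s_k); only used when k <= size s. *)
Definition init_tuple (E : nmodType) (k : nat) (s : seq E) : k.-tuple E :=
  [tuple s`_i | i < k].

Section RationalSpace.
Variables (V : vectType rat) (q : {symmetric V}).

Definition has_signature (r s : nat) : Prop :=
  exists f : (r + s).-tuple V,
    [/\ basis_of fullv f,
        forall i j, i != j -> q (tnth f i) (tnth f j) = 0,
        forall i : 'I_(r + s), (i < r)%N -> 0 < q (tnth f i) (tnth f i) &
        forall i : 'I_(r + s), (r <= i)%N -> q (tnth f i) (tnth f i) < 0].

(* An orientation is given by a basis o representing it. *)
Definition positively_oriented (d : nat) (o e : d.-tuple V) : Prop :=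
  0 < \det (coord_mx o e).

Definition witt_tuple (m : nat) (u0 : V) (w : m.-tuple V) (u0' : V) :
  m.+2.-tuple V := [tuple of u0 :: rcons w u0'].

Definition isWittBasis (m : nat) (o : m.+2.-tuple V)
    (u0 : V) (w : m.-tuple V) (u0' : V) : Prop :=
  [/\ basis_of fullv (witt_tuple u0 w u0'),
      positively_oriented o (witt_tuple u0 w u0'),
      q u0 u0 = 0 /\ q u0' u0' = 0, q u0 u0' = - 2^-1 &
      [/\ free w,
          forall x, x \in <<w>>%VS <-> (q x u0 = 0 /\ q x u0' = 0) &
          forall x, x \in <<w>>%VS -> x != 0 -> 0 < q x x]].

End RationalSpace.

(* V(R) = V (x)_Q R, realized as the space of coordinate vectors with respect to
   a fixed basis of V; [toR] is the map x |-> x (x) 1 and [formR] the R-bilinear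
   extension of the form. *)
Notation realpts R V := ('rV[R]_(\dim {:V})).

Section RealPoints.
Variables (R : realType) (V : vectType rat) (q : {symmetric V}).
Local Notation VR := (realpts R V).

Definition toR (x : V) : VR := \row_i ratr (coord (vbasis fullv) i x).

Definition gramR : 'M[R]_(\dim {:V}) :=
  \matrix_(i, j) ratr (q (tnth (vbasis fullv) i) (tnth (vbasis fullv) j)).

Definition formR (x y : VR) : R := (x *m gramR *m y^T) 0 0.

Definition orthR (x y : VR) : Prop := formR x y = 0.

Definition hyperboloid (Z0 : VR) : set VR :=
  connected_component [set Z | formR Z Z = -1] Z0.

Definition projline (Z x : VR) : VR := (formR x Z / formR Z Z) *: Z.

Definition projperp (Z x : VR) : VR := x - projline Z x.

Definition form_at (Z x y : VR) : R :=
  formR (projperp Z x) (projperp Z y) - formR (projline Z x) (projline Z y).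

(* Written as a total function; it is meant for Z in B and xi_j in T_Z(B) = Z^perp,
   which is where the chart takes it, by [Zchart_hyperboloid] and
   [derive_Zchart_tangent] below. *)
Definition phi_form (n : nat) (Z : VR) (X : n.-tuple VR) (xi : 'I_n -> VR) : R :=
  2 `^ (n%:R / 2) * \det (\matrix_(i, j) formR (tnth X i) (xi j))
  * expR (- pi * \tr (\matrix_(i, j) form_at Z (tnth X i) (tnth X j))).

Section Chart.
Variables (m : nat) (u0 u0' : V).

Definition Zpt (t : R) (b : VR) : VR :=
  (t + t^-1 * formR b b) *: toR u0 + t^-1 *: b + t^-1 *: toR u0'.

Definition basepoint : VR := toR u0 + toR u0'.

(* [e] is (e_2, ..., e_p), where p = m + 1, and e_1 = u_0 - u_0'. *)
Definition isOrthonormalFrame (e : m.-tuple VR) : Prop :=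
  let e1p := [tuple of (toR u0 - toR u0') :: e] in
  [/\ forall i, orthR (tnth e1p i) basepoint,
      forall x, orthR x basepoint -> x \in <<e1p>>%VS &
      forall i j, formR (tnth e1p i) (tnth e1p j) = (i == j)%:R].

Definition inWR (x : VR) : Prop := orthR x (toR u0) /\ orthR x (toR u0').

(* With U' = span(w_1, ..., w_k): e_2, ..., e_{k+1} lie in U'(R), and the
   remaining e_i in U''(R), the orthogonal complement of U'(R) in W(R). *)
Definition splits_along (k : nat) (w : m.-tuple V) (e : m.-tuple VR) : Prop :=
  forall i : 'I_m,
    ((i < k)%N -> tnth e i \in <<[seq toR x | x <- take k w]>>%VS) /\
    ((k <= i)%N -> inWR (tnth e i) /\
       forall j : 'I_m, (j < k)%N -> orthR (tnth e i) (toR (tnth w j))).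

Definition vecW (e : m.-tuple VR) (b : 'rV[R]_m) : VR :=
  \sum_i b 0 i *: tnth e i.

Definition Zchart (e : m.-tuple VR) (x : R * 'rV[R]_m) : VR :=
  Zpt x.1 (vecW e x.2).

End Chart.

(* The determinant of (w_1, ..., w_k) with respect to (e_2, ..., e_{k+1}), i.e. the
   signed volume of the parallelepiped spanned by the w_i. It is 1 when
   w_i = e_{i+1}. *)
Definition volume_factor (m k : nat) (w : m.-tuple V) (e : m.-tuple VR) : R :=
  \det (coord_mx (init_tuple k e) (init_tuple k [seq toR x | x <- w])).

(* (b', b'') |-> (b', 0), where b' consists of the first k coordinates. *)
Definition headpart (m k : nat) (b : 'rV[R]_m) : 'rV[R]_m :=
  \row_i (if (i < k)%N then b 0 i else 0).

End RealPoints.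

Section CoordinateForms.
Variables (R : realType) (m : nat).
Local Notation M := (R * 'rV[R]_m)%type.

Definition dt (v : M) : R := v.1.

Definition db (i : 'I_m) (v : M) : R := v.2 0 i.

Definition coordinate_forms : seq (M -> R) := dt :: [tuple db i | i < m].

(* The wedge product without the factor 1/n!. *)
Definition wedge (n : nat) (a : 'I_n -> M -> R) (v : 'I_n -> M) : R :=
  \det (\matrix_(i, j) a i (v j)).

(* dt /\ db_1 /\ ... /\ db_(n-1) *)
Definition dt_db (n : nat) : ('I_n -> M) -> R :=
  wedge (fun i => nth dt coordinate_forms i).

(* The pullback along f of the n-form on the target whose value at the point y
   is [a y]. *)
Definition pullback_form (E : normedModType R) (n : nat) (f : M -> E)
    (a : E -> ('I_n -> E) -> R) (x : M) (v : 'I_n -> M) : R :=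
  a (f x) (fun j => 'D_(v j) f x).

End CoordinateForms.

Section FormTheory.
Variables (R : realType) (V : vectType rat) (q : {symmetric V}).
Local Notation VR := (realpts R V).
Local Notation F := (@formR R V q).
Lemma formRE x y : F x y = \sum_i \sum_j x 0 i * gramR R q i j * y 0 j.
Proof.
rewrite /formR mxE exchange_big; apply: eq_bigr => j _ /=.
by rewrite !mxE big_distrl /=; apply: eq_bigr => i _; rewrite !mxE.
Qed.
Lemma symform_sym x y : q x y = q y x.
Proof. by rewrite hermC /= expr0 mul1r. Qed.
Lemma formRC x y : F x y = F y x.
Proof.
rewrite !formRE exchange_big; apply: eq_bigr => i _; apply: eq_bigr => j _ /=.
by rewrite !mxE symform_sym; ring.
Qed.
Lemma formRDl x y z : F (x + y) z = F x z + F y z.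
Proof. by rewrite /formR !mulmxDl mxE. Qed.
Lemma formRZl a x z : F (a *: x) z = a * F x z.
Proof. by rewrite /formR -!scalemxAl mxE. Qed.
Lemma formRDr x y z : F z (x + y) = F z x + F z y.
Proof. by rewrite ![F z _]formRC formRDl. Qed.
Lemma formRZr a x z : F z (a *: x) = a * F z x.
Proof. by rewrite ![F z _]formRC formRZl. Qed.
Lemma formRNl x z : F (- x) z = - F x z.
Proof. by rewrite -scaleN1r formRZl mulN1r. Qed.
Lemma formRNr x z : F z (- x) = - F z x.
Proof. by rewrite ![F z _]formRC formRNl. Qed.
Lemma formR0l x : F 0 x = 0. Proof. by rewrite -(scale0r 0) formRZl mul0r. Qed.
Lemma formR_suml (I : finType) (P : pred I) (f : I -> VR) z :
  F (\sum_(i | P i) f i) z = \sum_(i | P i) F (f i) z.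
Proof. by elim/big_rec2: _ => [|i a b _ <-]; rewrite ?formR0l ?formRDl. Qed.
Lemma formR_sumr (I : finType) (P : pred I) (f : I -> VR) z :
  F z (\sum_(i | P i) f i) = \sum_(i | P i) F z (f i).
Proof. by rewrite formRC formR_suml; apply: eq_bigr => i _; rewrite formRC. Qed.
Lemma formR_toR x y : F (toR R x) (toR R y) = ratr (q x y).
Proof.
rewrite formRE.
rewrite [in RHS](coord_vbasis (memvf x)) [in RHS](coord_vbasis (memvf y)).
rewrite linear_sumlz /= rmorph_sum; apply: eq_bigr => i _ /=.
rewrite linear_sumr /= rmorph_sum; apply: eq_bigr => j _ /=.
have -> : q (coord (vbasis fullv) i x *: (vbasis fullv)`_i)
      (coord (vbasis fullv) j y *: (vbasis fullv)`_j) =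
  coord (vbasis fullv) i x * (coord (vbasis fullv) j y * q (vbasis fullv)`_i (vbasis fullv)`_j).
  by rewrite linearZl_LR linearZr_LR.
rewrite (rmorphM (ratr : rat -> R)) (rmorphM (ratr : rat -> R)) !mxE !(tnth_nth 0).
by rewrite mulrAC mulrA.
Qed.
End FormTheory.

Section DerivativeFacts.
Variables (R : realType) (E : normedModType R).
Lemma is_derive_lin (L : E -> R) (x v : E) :
  (forall h y, L (h *: v + y) = h * L v + L y) -> is_derive x v L (L v).
Proof.
move=> HL.
have H : (h^-1 *: (L (h *: v + x) - L x)) @[h --> 0^'] --> L v.
  apply: (@cvg_trans _ ((fun=> L v) @ 0^')); last exact: cvg_cst.
  apply: near_eq_cvg; near=> h; rewrite HL addrK.
  rewrite -[RHS]/(h^-1 * (h * L v)) mulKf //.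
  by near: h; exact: nbhs_dnbhs_neq.
by apply: DeriveDef; [apply/cvg_ex; exists (L v) | exact/cvg_lim].
Unshelve. all: by end_near. Qed.

Lemma is_derive_mx m n (M : E -> 'M[R]_(m, n)) (D : 'M[R]_(m, n)) x v :
  (forall i j, is_derive x v (fun y => M y i j) (D i j)) -> is_derive x v M D.
Proof.
move=> H.
have dM : derivable M x v by apply/derivable_mxP => i j; case: (H i j).
apply: DeriveDef => //; rewrite derive_mx //; apply/matrixP => i j.
by rewrite mxE; case: (H i j).
Qed.
End DerivativeFacts.

Section ChartTheory.
Variables (R : realType) (V : vectType rat) (q : {symmetric V}).
Local Notation VR := (realpts R V).
Local Notation F := (@formR R V q).
Variables (m : nat) (u0 u0' : V) (e : m.-tuple VR).

Definition dZchart (x v : R * 'rV[R]_m) : VR :=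
  (v.1 - v.1 / x.1 ^+ 2 * F (vecW e x.2) (vecW e x.2)
   + x.1^-1 * (2 * F (vecW e x.2) (vecW e v.2))) *: toR R u0
  + (x.1^-1 *: vecW e v.2 - (v.1 / x.1 ^+ 2) *: vecW e x.2)
  - (v.1 / x.1 ^+ 2) *: toR R u0'.

Lemma vecW_lin h (v y : 'rV[R]_m) : vecW e (h *: v + y) = h *: vecW e v + vecW e y.
Proof.
rewrite /vecW scaler_sumr -big_split; apply: eq_bigr => i _ /=.
by rewrite !mxE scalerDl scalerA.
Qed.

Lemma is_derive_Zchart x v : x.1 != 0 -> is_derive x v (Zchart q u0 u0' e) (dZchart x v).
Proof.
move=> x0.
have H1 : is_derive x v (fun y : R * 'rV[R]_m => y.1) v.1 by apply: is_derive_lin.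
have HV : is_derive x v (fun y : R * 'rV[R]_m => y.1^-1) (- x.1 ^- 2 *: v.1).
  apply: DeriveDef; first by apply: derivableV => //; case: H1.
  by rewrite deriveV //; case: H1 => _ ->.
have HW k : is_derive x v (fun y : R * 'rV[R]_m => vecW e y.2 0 k) (vecW e v.2 0 k).
  by apply: is_derive_lin => h y; rewrite vecW_lin !mxE.
have HN : is_derive x v (fun y : R * 'rV[R]_m => F (vecW e y.2) (vecW e y.2))
     (2 * F (vecW e x.2) (vecW e v.2)).
  rewrite (_ : (fun y => _) =
     \sum_k (\sum_l (fun y : R * 'rV[R]_m => gramR R q k l *: (vecW e y.2 0 k * vecW e y.2 0 l)))).
  apply: is_derive_eq.
    rewrite mulrDl mul1r {2}formRC !formRE -big_split; apply: eq_bigr => k _ /=.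
    rewrite -big_split; apply: eq_bigr => l _ /=.
    by rewrite /GRing.scale /=; ring.
  apply/funext => y; rewrite formRE fct_sumE; apply: eq_bigr => k _.
  by rewrite fct_sumE; apply: eq_bigr => l _; rewrite /GRing.scale /=; ring.
apply: is_derive_mx => i j; rewrite (ord1 i).
rewrite (_ : (fun y => _) = (fun y : R * 'rV[R]_m => 
   toR R u0 0 j *: (y.1 + y.1^-1 * F (vecW e y.2) (vecW e y.2))
   + y.1^-1 * vecW e y.2 0 j + toR R u0' 0 j *: y.1^-1)); last first.
  by apply/funext => y; rewrite !mxE /GRing.scale /=; ring.
apply: is_derive_eq.
rewrite ![dZchart _ _ _ _]mxE ![in RHS]mxE [toR R u0 0 j]mxE [toR R u0' 0 j]mxE.
rewrite /GRing.scale /=.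
move: (ratr _) (ratr _) (vecW e v.2 0 j) (vecW e x.2 0 j) (F _ _) (F _ _).
by move=> A B C D E G; field.
Qed.

Hypothesis F00 : q u0 u0 = 0.
Hypothesis F11 : q u0' u0' = 0.
Hypothesis F01 : q u0 u0' = - 2^-1.
Hypothesis eW : forall i, inWR q u0 u0' (tnth e i).

Let rF01 : F (toR R u0) (toR R u0') = - 2^-1.
Proof. by rewrite formR_toR F01 rmorphN /= fmorphV /= ratr_nat. Qed.
Let rF10 : F (toR R u0') (toR R u0) = - 2^-1.
Proof. by rewrite formRC rF01. Qed.
Let rF00 : F (toR R u0) (toR R u0) = 0.
Proof. by rewrite formR_toR F00 rmorph0. Qed.
Let rF11 : F (toR R u0') (toR R u0') = 0.
Proof. by rewrite formR_toR F11 rmorph0. Qed.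
Let W0 b : F (vecW e b) (toR R u0) = 0.
Proof.
rewrite /vecW formR_suml big1 // => i _; rewrite formRZl.
by case: (eW i) => -> _; rewrite mulr0.
Qed.
Let W1 b : F (vecW e b) (toR R u0') = 0.
Proof.
rewrite /vecW formR_suml big1 // => i _; rewrite formRZl.
by case: (eW i) => _ ->; rewrite mulr0.
Qed.

Lemma formR_Zchart x : x.1 != 0 -> F (Zchart q u0 u0' e x) (Zchart q u0 u0' e x) = -1.
Proof.
move=> x0; rewrite /Zchart /Zpt !(formRDl, formRDr, formRZl, formRZr).
rewrite rF00 rF01 rF10 rF11 !(formRC q (toR R _) (vecW e _)) !W0 !W1.
by field.
Qed.

Lemma dZchart_tangent x v : x.1 != 0 -> F (dZchart x v) (Zchart q u0 u0' e x) = 0.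
Proof.
move=> x0; rewrite /Zchart /Zpt /dZchart !(formRDl, formRDr, formRZl, formRZr, formRNl, formRNr).
rewrite rF00 rF01 rF10 rF11 !(formRC q (toR R _) (vecW e _)) !W0 !W1.
rewrite (formRC q (vecW e v.2)).
by field.
Qed.

Lemma derive_Zchart x v : x.1 != 0 -> 'D_v (Zchart q u0 u0' e) x = dZchart x v.
Proof. by move=> x0; case: (is_derive_Zchart v x0). Qed.

Lemma derive_Zchart_tangent x v : x.1 != 0 ->
  orthR q ('D_v (Zchart q u0 u0' e) x) (Zchart q u0 u0' e x).
Proof. by move=> x0; rewrite derive_Zchart //; exact: dZchart_tangent. Qed.

Lemma Zchart_hyperboloid x : 0 < x.1 ->
  hyperboloid q (basepoint R u0 u0') (Zchart q u0 u0' e x).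
Proof.
case: x => t b /= t0.
set v : R * 'rV[R]_m := (t - 1, b); set x0 : R * 'rV[R]_m := (1, 0).
pose c (s : R) := Zchart q u0 u0' e (s *: v + x0).
have pos s : s \in `[0, 1] -> 0 < (s *: v + x0).1.
  rewrite in_itv /= => /andP[s0 s1].
  change (0 < s * (t - 1) + 1); nra.
have c0 : c 0 = basepoint R u0 u0'.
  rewrite /c scale0r add0r /Zchart /Zpt /x0 /=.
  have -> : vecW e 0 = 0 by rewrite /vecW big1 // => i _; rewrite mxE scale0r.
  by rewrite formR0l invr1 mulr0 addr0 !scale1r addr0.
have c1 : c 1 = Zchart q u0 u0' e (t, b).
  rewrite /c scale1r; congr Zchart; congr pair => /=; first by rewrite subrK.
  by rewrite addr0.
have cc : {within `[0, 1], continuous c}.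
  apply: continuous_in_subspaceT => s /set_mem /= sI.
  apply: differentiable_continuous; apply/derivable1_diffP.
  have := @is_derive_Zchart (s *: v + x0) v (lt0r_neq0 (pos _ sI)).
  case=> H _; move: H; rewrite /derivable.
  set f := (X in cvg (X @ _) -> _); set g := (X in _ -> cvg (X @ _)).
  suff -> : f = g by [].
  apply/funext => h; rewrite /f /g /c /= scalerDl addrA.
  by rewrite [h%:A]mulr1.
apply: (@connected_component_max _ _ (c @` `[0, 1])).
- by exists 0 => //; rewrite /= in_itv /= lexx ler01.
- by move=> _ [s /pos sp <-] /=; rewrite formR_Zchart // lt0r_neq0.
- by apply: connected_continuous_connected cc; exact: segment_connected.
- by rewrite -c1; exists 1 => //; rewrite /= in_itv /= lexx ler01.
Qed.
End ChartTheory.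

(* Main.v *)
Require Import Defs.
From HB Require Import structures.
From mathcomp Require Import all_boot all_order all_algebra.
From mathcomp Require Import all_classical all_reals all_analysis.
From mathcomp Require Import ring lra.

Set Implicit Arguments.
Unset Strict Implicit.
Unset Printing Implicit Defensive.

Import Order.TTheory GRing.Theory Num.Theory.
Import numFieldNormedType.Exports.

Local Open Scope classical_set_scope.
Local Open Scope ring_scope.

(** Write f = (u_0, w_1, ..., w_(n-1)), so that X = f g and the determinant in
    phi_n is det g times that of the matrix (f_i, dZ(v_j)).  The latter is
    A (db_i(v_j)) with db_0 = dt and A block lower triangular, with diagonal
    blocks 1/(2 t^2) and t^-1 C^T, C expressing the w_i in the orthonormal basis
    (e_2, ..., e_n) of U'; hence det A = vol * t^(-n-1) / 2.  As (Z, Z) = -1,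
    (x, y)_Z = (x, y) + 2 (x, Z) (y, Z), and for x in U the value (x, Z(t, b))
    depends on b' only, because U is orthogonal to u_0 and to U''. *)

Lemma det_row0 (K : comNzRingType) (n : nat) (A : 'M[K]_n.+1) :
  (forall j, A ord0 (lift ord0 j) = 0) ->
  \det A = A ord0 ord0 * \det (row' ord0 (col' ord0 A)).
Proof.
move=> A0; rewrite (expand_det_row _ ord0) big_ord_recl big1 ?addr0 => [|j _].
  by rewrite /cofactor expr0 mul1r.
by rewrite A0 mul0r.
Qed.

Section RealForm.
Variables (R : realType) (V : vectType rat) (q : {symmetric V}).
Local Notation VR := (realpts R V).
Local Notation F := (@formR R V q).

(** The component of x along Z is -(x, Z) Z, so the product of the two line components is -(x, Z)
    (y, Z); it is subtracted once in passing to Z^perp and once more by the sign change on the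
    line. *)
Lemma form_atE (Z x y : VR) :
  F Z Z = -1 -> form_at q Z x y = F x y + 2 * (F x Z * F y Z).
Proof.
move=> ZZ; rewrite /form_at /projperp /projline.
rewrite !(formRDl, formRDr, formRNl, formRNr, formRZl, formRZr) ZZ.
by rewrite (formRC q Z y) invrN1; ring.
Qed.

Lemma orthonormal_free (k : nat) (f : k.-tuple VR) :
  (forall i j, F (tnth f i) (tnth f j) = (i == j)%:R) -> free f.
Proof.
move=> Hf; apply/freeP => c Hc i.
have : F (\sum_j c j *: f`_j) (tnth f i) = 0 by rewrite Hc formR0l.
rewrite formR_suml (bigD1 i) //= big1 => [|j /negPf ji].
  by rewrite -tnth_nth formRZl Hf eqxx mulr1 addr0.
by rewrite -tnth_nth formRZl Hf ji mulr0.
Qed.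

(** Serves twice: for X in the frame of U, where it splits off g, and for the w_i in the e_(i+1),
    where it produces [C]. *)
Lemma formR_coord_mx (n : nat) (f x : n.-tuple VR) (y : VR) i :
  (forall j, tnth x j \in <<f>>%VS) ->
  F (tnth x i) y = \sum_k coord_mx f x k i * F (tnth f k) y.
Proof.
move=> xf; rewrite {1}(coord_span (xf i)) formR_suml; apply: eq_bigr => k _.
by rewrite formRZl mxE -tnth_nth.
Qed.

Section Frame.
Variables (m k : nat) (u0 u0' : V) (w : m.-tuple V) (e : m.-tuple VR).
Hypothesis km : (k <= m)%N.
Hypothesis F00 : q u0 u0 = 0.
Hypothesis F01 : q u0 u0' = - 2^-1.
Hypothesis wW : forall i, q (tnth w i) u0 = 0 /\ q (tnth w i) u0' = 0.
Hypothesis he : isOrthonormalFrame q u0 u0' e.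
Hypothesis hsplit : splits_along q u0 u0' k w e.

Local Notation wid := (widen_ord km).

Lemma orthonormal_frameE i j : F (tnth e i) (tnth e j) = (i == j)%:R.
Proof.
case: he => _ _ /(_ (lift ord0 i) (lift ord0 j)).
by rewrite !tnthS (inj_eq lift_inj).
Qed.

(** Each e_i is orthogonal to Z_0 = u_0 + u_0' and to e_1 = u_0 - u_0', hence to u_0 and to u_0'. *)
Lemma orthonormal_frame_inWR i : inWR q u0 u0' (tnth e i).
Proof.
case: he => /(_ (lift ord0 i)) + _ /(_ (lift ord0 i) ord0).
rewrite /orthR /basepoint !tnthS tnth0 eq_sym eq_liftF /inWR /orthR.
rewrite formRDr formRDr formRNr /=.
by set a := formR _ _ _; set c := formR _ _ _ => H1 H2; split; lra.
Qed.

Lemma tnth_init_e (i : 'I_k) : tnth (init_tuple k e) i = tnth e (wid i).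
Proof. by rewrite tnth_mktuple (tnth_nth 0). Qed.

Lemma tnth_init_w (i : 'I_k) :
  tnth (init_tuple k [seq toR R x | x <- w]) i = toR R (tnth w (wid i)).
Proof.
by rewrite tnth_mktuple (nth_map 0) ?size_tuple ?(tnth_nth 0) // (leq_trans _ km).
Qed.

Lemma tnth_frame0 :
  tnth (init_tuple k.+1 [seq toR R x | x <- u0 :: w]) ord0 = toR R u0.
Proof. by rewrite tnth_mktuple. Qed.

Lemma tnth_frameS (i : 'I_k) :
  tnth (init_tuple k.+1 [seq toR R x | x <- u0 :: w]) (lift ord0 i)
  = toR R (tnth w (wid i)).
Proof. by rewrite -tnth_init_w !tnth_mktuple lift0. Qed.

(** The splitting only gives that the first k of the e_i lie in the span of the w_i; equality of the
    spans follows by dimension, since k orthonormal vectors are free. *)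
Lemma toR_w_span (i : 'I_k) : toR R (tnth w (wid i)) \in <<init_tuple k e>>%VS.
Proof.
have -> : <<init_tuple k e>>%VS = <<[seq toR R x | x <- take k w]>>%VS.
  apply/eqP; rewrite eqEdim; apply/andP; split.
    apply/span_subvP => _ /tnthP[j ->]; rewrite tnth_init_e.
    by case: (hsplit (wid j)) => + _; apply => /=.
  rewrite (eqP (_ : free (init_tuple k e))); last first.
    apply: orthonormal_free => j l; rewrite !tnth_init_e orthonormal_frameE.
    by congr (_%:R); congr nat_of_bool; apply/eqP/eqP => [/(congr1 val)/= /val_inj|->].
  rewrite size_tuple (leq_trans (dim_span _)) // size_map size_takel //.
  by rewrite size_tuple.
apply: memv_span; apply: map_f; rewrite (tnth_nth 0) /=.
by rewrite -(nth_take 0 (ltn_ord i)) mem_nth // size_takel // size_tuple.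
Qed.

Lemma formR_e_vecW i (c : 'rV[R]_m) : F (tnth e i) (vecW e c) = c 0 i.
Proof.
rewrite /vecW formR_sumr (bigD1 i) //= big1 ?addr0 => [|j /negPf ji].
  by rewrite formRZr orthonormal_frameE eqxx mulr1.
by rewrite formRZr orthonormal_frameE eq_sym ji mulr0.
Qed.

Local Notation C :=
  (coord_mx (init_tuple k e) (init_tuple k [seq toR R x | x <- w])).

(** Only the first k coordinates of c occur: this leaves just db_1, ..., db_k in the form and
    removes b'' from the exponent. *)
Lemma formR_w_vecW (i : 'I_k) (c : 'rV[R]_m) :
  F (toR R (tnth w (wid i))) (vecW e c) = \sum_l C l i * c 0 (wid l).
Proof.
rewrite -tnth_init_w (@formR_coord_mx _ (init_tuple k e)) => [|j].
  by apply: eq_bigr => l _; rewrite tnth_init_e formR_e_vecW.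
by rewrite tnth_init_w toR_w_span.
Qed.

Lemma formR_vecW_u0 c : F (toR R u0) (vecW e c) = 0.
Proof.
rewrite formR_sumr big1 // => i _; rewrite formRZr formRC.
by case: (orthonormal_frame_inWR i) => -> _; rewrite mulr0.
Qed.

Lemma formR_u0_u0' : F (toR R u0) (toR R u0') = - 2^-1.
Proof. by rewrite formR_toR F01 rmorphN /= fmorphV /= ratr_nat. Qed.

(** Only the u_0' component -t^-2 dt of dZ pairs nontrivially with u_0; the factor 1/2 is -(u_0,
    u_0'). *)
Lemma formR_u0_dZchart x v :
  F (toR R u0) (dZchart q u0 u0' e x v) = 2^-1 * x.1 ^- 2 * v.1.
Proof.
rewrite !(formRDr, formRNr, formRZr) !formR_vecW_u0 formR_u0_u0' formR_toR F00.
by rewrite rmorph0; ring.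
Qed.

Lemma formR_w_u0 i : F (toR R (tnth w i)) (toR R u0) = 0.
Proof. by rewrite formR_toR (wW i).1 rmorph0. Qed.

Lemma formR_w_u0' i : F (toR R (tnth w i)) (toR R u0') = 0.
Proof. by rewrite formR_toR (wW i).2 rmorph0. Qed.

Lemma formR_w_dZchart i x v :
  F (toR R (tnth w i)) (dZchart q u0 u0' e x v)
  = - x.1 ^- 2 * F (toR R (tnth w i)) (vecW e x.2) * v.1
    + x.1^-1 * F (toR R (tnth w i)) (vecW e v.2).
Proof.
by rewrite !(formRDr, formRNr, formRZr) formR_w_u0 formR_w_u0'; ring.
Qed.

Lemma det_frame_dZchart x (v : 'I_k.+1 -> R * 'rV[R]_m) :
  \det (\matrix_(i, j) F (tnth (init_tuple k.+1 [seq toR R x | x <- u0 :: w]) i)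
                         (dZchart q u0 u0' e x (v j)))
  = volume_factor k w e * (2^-1 * x.1 ^- k.+2 * dt_db v).
Proof.
(* Rows follow u_0, w_1, ..., w_k and columns dt, db_1, ..., db_k. *)
pose A : 'M[R]_k.+1 := \matrix_(i, j)
  match unlift ord0 i, unlift ord0 j with
  | None, None => 2^-1 * x.1 ^- 2
  | None, Some _ => 0
  | Some i', None => - x.1 ^- 2 * F (toR R (tnth w (wid i'))) (vecW e x.2)
  | Some i', Some l => x.1^-1 * C l i'
  end.
(* As k <= m, the default [dt] of [nth] is never reached. *)
pose D : 'M[R]_k.+1 := \matrix_(i, j) nth (@dt R m) (coordinate_forms R m) i (v j).
have D0 j : D ord0 j = (v j).1 by rewrite mxE.
have DS i j : D (lift ord0 i) j = (v j).2 0 (wid i).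
  rewrite mxE lift0 /=.
  have im : (i < m)%N by rewrite (leq_trans _ km).
  rewrite (nth_map (wid i)) ?size_enum_ord //.
  by rewrite /db; congr ((v j).2 0 _); apply: val_inj; rewrite /= nth_enum_ord.
rewrite (_ : \matrix_(i, j) _ = A *m D).
  rewrite det_mulmx det_row0 => [|j]; last by rewrite mxE unlift_none liftK.
  rewrite (_ : row' ord0 (col' ord0 A) = x.1^-1 *: C^T); last first.
    by apply/matrixP => i j; rewrite !mxE !liftK mxE.
  (* The corner contributes t^-2 and the k rows of the lower block t^-1 each. *)
  rewrite detZ det_tr mxE unlift_none /dt_db /wedge -/D /volume_factor.
  by rewrite -!exprVn -[k.+2]addn2 exprD; ring.
apply/matrixP => i j; rewrite !mxE big_ord_recl D0.
case: (unliftP ord0 i) => [i'|] ->.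
  rewrite tnth_frameS formR_w_dZchart mxE liftK unlift_none; congr (_ + _).
  rewrite formR_w_vecW mulr_sumr; apply: eq_bigr => l _.
  by rewrite DS [A _ _]mxE !liftK mulrA.
rewrite tnth_frame0 formR_u0_dZchart mxE unlift_none big1 ?addr0 // => l _.
by rewrite mxE unlift_none liftK mul0r.
Qed.

(** The u_0 coefficient of Z(t, b) involves b'' through (b, b), but u_0 is orthogonal to the whole
    frame. *)
Lemma formR_frame_headpart i t b :
  F (tnth (init_tuple k.+1 [seq toR R x | x <- u0 :: w]) i)
    (Zchart q u0 u0' e (t, headpart k b))
  = F (tnth (init_tuple k.+1 [seq toR R x | x <- u0 :: w]) i)
      (Zchart q u0 u0' e (t, b)).
Proof.
rewrite /Zchart /Zpt /= !(formRDr, formRZr).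
case: (unliftP ord0 i) => [i'|] ->.
  rewrite tnth_frameS formR_w_u0 !mulr0 !formR_w_vecW.
  by congr (_ + _ * _ + _); apply: eq_bigr => l _; rewrite [headpart _ _ _ _]mxE /= ltn_ord.
by rewrite tnth_frame0 formR_toR F00 rmorph0 !formR_vecW_u0 !mulr0.
Qed.

End Frame.
End RealForm.

Theorem lemma6p4 (R : realType) (p n : nat) (hn : (1 <= n <= p)%N)
  (V : vectType rat) (hV : \dim {:V} = p.+1)
  (q : {symmetric V}) (hq : has_signature q p 1)
  (o : p.-1.+2.-tuple V) (ho : basis_of fullv o)
  (u0 u0' : V) (w : p.-1.-tuple V) (hw : isWittBasis q o u0 w u0')
  (e : p.-1.-tuple (realpts R V)) (he : isOrthonormalFrame q u0 u0' e)
  (hsplit : splits_along q u0 u0' n.-1 w e)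
  (X : n.-tuple (realpts R V)) (hX : free X)
  (hspan : <<X>>%VS = <<init_tuple n [seq toR R x | x <- u0 :: w]>>%VS)
  (t : R) (ht : 0 < t) (b : 'rV[R]_p.-1) (v : 'I_n -> R * 'rV[R]_p.-1) :
  let g := coord_mx (init_tuple n [seq toR R x | x <- u0 :: w]) X in
  let vol := volume_factor n.-1 w e in
  let rhs :=
    2 `^ (n%:R / 2) * (2^-1 * \det g)
    * expR (- pi * \tr (\matrix_(i, j)
        form_at q (Zchart q u0 u0' e (t, headpart n.-1 b)) (tnth X i) (tnth X j)))
    * t ^- n.+1 * dt_db v in
  let lhs := pullback_form (Zchart q u0 u0' e) (fun Z xi => phi_form q Z X xi) (t, b) v in
  (vol = 1 -> lhs = rhs) /\ lhs = vol * rhs.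
Proof.
move=> g vol rhs lhs.
(* The factor [vol] compares the w_i, to which g refers, with the e_(i+1), to which the db_i
   refer. *)
suff main : lhs = vol * rhs by split => // vol1; rewrite main vol1 mul1r.
rewrite {}/lhs {}/rhs {}/vol {}/g.
(* The bounds 1 <= n <= p leave only n = k + 1 and p = m + 1. *)
case: n p => [|k] [|m] //= in hn hV o ho w hw e he hsplit X hX hspan b v hq *.
have km : (k <= m)%N := hn.
have [_ _ [F00 F11] F01 [_ wW _]] := hw.
have wW' i : q (tnth w i) u0 = 0 /\ q (tnth w i) u0' = 0.
  by apply/wW; rewrite memv_span // mem_tnth.
have t0 : t != 0 by rewrite gt_eqF.
set f := init_tuple k.+1 _ in hspan *.
have Xf j : tnth X j \in <<f>>%VS by rewrite -hspan memv_span // mem_tnth.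
have ZZ c : formR q (Zchart q u0 u0' e (t, c)) (Zchart q u0 u0' e (t, c)) = -1.
  exact: (formR_Zchart F00 F11 F01 (orthonormal_frame_inWR he)).
have XZ i : formR q (tnth X i) (Zchart q u0 u0' e (t, headpart k b))
          = formR q (tnth X i) (Zchart q u0 u0' e (t, b)).
  rewrite !(formR_coord_mx q _ _ Xf); apply: eq_bigr => l _.
  by rewrite (formR_frame_headpart km F00 wW' he hsplit).
rewrite /pullback_form /phi_form.
have -> : \matrix_(i, j) form_at q (Zchart q u0 u0' e (t, headpart k b)) (tnth X i) (tnth X j)
        = \matrix_(i, j) form_at q (Zchart q u0 u0' e (t, b)) (tnth X i) (tnth X j).
  by apply/matrixP => i j; rewrite !mxE !form_atE // !XZ.
have -> : \matrix_(i, j) formR q (tnth X i) ('D_(v j) (Zchart q u0 u0' e) (t, b))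
        = (coord_mx f X)^T *m \matrix_(i, j) formR q (tnth f i) (dZchart q u0 u0' e (t, b) (v j)).
  apply/matrixP => i j; rewrite !mxE derive_Zchart // (formR_coord_mx q _ _ Xf).
  by apply: eq_bigr => l _; rewrite !mxE.
rewrite det_mulmx det_tr (det_frame_dZchart km F00 F01 wW' he hsplit) /=.
by ring.
Qed.
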